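(* Let $\mathfrak{g}$ be a Lie algebra, $(M,\bullet)$ a $\mathfrak{g}$-module and $T : M \to \mathfrak{g}$ an $\mathcal{O}$-operator on $M$ over $\mathfrak{g}$. If $\Omega : \mathfrak{g} \to M$ is a solution of the strong Maurer-Cartan equation on the twilled Lie algebra $\mathfrak{g} \bowtie M^T$, then $(T, N = T \circ \Omega, S = \Omega \circ T)$ is an $\mathcal{ON}$-structure on the module $M$ over the Lie algebra $\mathfrak{g}$.
   Context: All vector spaces are over a field of characteristic $0$. An $\mathcal{O}$-operator on a $\mathfrak{g}$-module $(M,\bullet)$ over the Lie algebra $\mathfrak{g}$ is a linear map $T: M\to\mathfrak{g}$ with $[T(m),T(n)] = T(T(m)\bullet n - T(n)\bullet m)$ for all $m,n\in M$. For any linear map $T:M\to\mathfrak{g}$ put $[m,n]^T := T(m)\bullet n - T(n)\bullet m$; if $T$ is an $\mathcal{O}$-operator this is a Lie bracket on $M$, and $M^T$ denotes the Lie algebra $(M,[~,~]^T)$. A twilled Lie algebra $\mathfrak{a}\bowtie\mathfrak{b}$ is a Lie algebra which is the direct sum, as a vector space, of two Lie subalgebras $\mathfrak{a},\mathfrak{b}$. Decomposing $[x,u] = x\bullet_1 u - u\bullet_2 x$ for $x\in\mathfrak{a},u\in\mathfrak{b}$ (with $x\bullet_1 u\in\mathfrak{b}$, $u\bullet_2 x\in\mathfrak{a}$) gives representations $\bullet_1$ of $\mathfrak{a}$ on $\mathfrak{b}$ and $\bullet_2$ of $\mathfrak{b}$ on $\mathfrak{a}$. A linear map $\Omega:\mathfrak{a}\to\mathfrak{b}$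 is a solution of the strong Maurer-Cartan equation on $\mathfrak{a}\bowtie\mathfrak{b}$ if $d_{\mathrm{CE}}\Omega = 0$ and $\frac12[\Omega,\Omega]_{\mu_2}=0$, where for $x,y\in\mathfrak{a}$: $(d_{\mathrm{CE}}\Omega)(x,y) = x\bullet_1\Omega(y) - y\bullet_1\Omega(x) - \Omega([x,y])$ and $\frac12[\Omega,\Omega]_{\mu_2}(x,y) = [\Omega(x),\Omega(y)] - \Omega(\Omega(x)\bullet_2 y) + \Omega(\Omega(y)\bullet_2 x)$. For an $\mathcal{O}$-operator $T$, $\mathfrak{g}\bowtie M^T$ is the twilled Lie algebra on $\mathfrak{g}\oplus M$ with bracket $[[(x,m),(y,n)]]^T = ([x,y] + m\,\overline{\bullet}\,y - n\,\overline{\bullet}\,x,\ x\bullet n - y\bullet m + [m,n]^T)$, where $m\,\overline{\bullet}\,x = [T(m),x] + T(x\bullet m)$ (here $\mathfrak a=\mathfrak g$, $\mathfrak b=M^T$, $\bullet_1=\bullet$, $\bullet_2=\overline{\bullet}$). A Nijenhuis operator on $\mathfrak{g}$ is a linear map $N:\mathfrak{g}\to\mathfrak{g}$ with $[Nx,Ny] = N([Nx,y]+[x,Ny]-N[x,y])$. A Nijenhuis structure on $M$ over $\mathfrak{g}$ is a pair $(N,S)$ with $N\in\mathrm{End}(\mathfrak{g})$ a Nijenhuis operator and $S\in\mathrm{End}(M)$ satisfying $N(x)\bullet S(m) = S(N(x)\bullet m) + x\bullet S^2(m) - S(x\bullet S(m))$ for all $x\in\mathfrak{g}, m\in M$. An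 $\mathcal{ON}$-structure on $M$ over $\mathfrak{g}$ is a triple $(T,N,S)$ where $T$ is an $\mathcal{O}$-operator, $(N,S)$ is a Nijenhuis structure, $N\circ T = T\circ S$, and $[m,n]^{N\circ T} = [m,n]^T_S$ for all $m,n\in M$, where $[m,n]^T_S := [S(m),n]^T + [m,S(n)]^T - S([m,n]^T)$. *)

(* Defs.v *)
From mathcomp Require Import all_boot all_algebra.

Set Implicit Arguments.
Unset Strict Implicit.
Unset Printing Implicit Defensive.

Import GRing.Theory.
Local Open Scope ring_scope.

Section LieAlgebras.
Variable K : fieldType.

Definition is_bilinear (U V W : lmodType K) (f : U -> V -> W) : Prop :=
  (forall v, linear (f ^~ v)) /\ (forall u, linear (f u)).

Definition is_lie (g : lmodType K) (br : g -> g -> g) : Prop :=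
  [/\ is_bilinear br,
      forall x, br x x = 0
    & forall x y z, br x (br y z) + br y (br z x) + br z (br x y) = 0].

Definition is_lie_module (g M : lmodType K) (br : g -> g -> g)
    (act : g -> M -> M) : Prop :=
  is_bilinear act
  /\ forall x y m, act (br x y) m = act x (act y m) - act y (act x m).

(* The subspaces of a * b are a = a x 0 and b = 0 x b, so br is a Lie bracket
   on the direct sum for which both summands are Lie subalgebras. *)
Definition is_twilled (a b : lmodType K) (br : a * b -> a * b -> a * b) : Prop :=
  [/\ is_lie br,
      forall x y : a, (br (x, 0) (y, 0)).2 = 0
    & forall u v : b, (br (0, u) (0, v)).1 = 0].

Section Twilled.
Variables (a b : lmodType K) (br : a * b -> a * b -> a * b).

Definition tw_brL (x y : a) : a := (br (x, 0) (y, 0)).1.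
Definition tw_brR (u v : b) : b := (br (0, u) (0, v)).2.

(* The components of [x, u] = tw_act1 x u - tw_act2 u x. *)
Definition tw_act1 (x : a) (u : b) : b := (br (x, 0) (0, u)).2.
Definition tw_act2 (u : b) (x : a) : a := - (br (x, 0) (0, u)).1.

Definition d_CE (Omega : a -> b) (x y : a) : b :=
  tw_act1 x (Omega y) - tw_act1 y (Omega x) - Omega (tw_brL x y).

(* This is (1/2) [Omega, Omega]_{mu_2}. *)
Definition half_mu2 (Omega : a -> b) (x y : a) : b :=
  tw_brR (Omega x) (Omega y)
  - Omega (tw_act2 (Omega x) y) + Omega (tw_act2 (Omega y) x).

Definition strong_MC (Omega : {linear a -> b}) : Prop :=
  (forall x y, d_CE Omega x y = 0) /\ (forall x y, half_mu2 Omega x y = 0).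

End Twilled.

Section Operators.
Variables (g M : lmodType K) (br : g -> g -> g) (act : g -> M -> M).

Definition brT (T : M -> g) (m n : M) : M := act (T m) n - act (T n) m.

Definition O_operator (T : {linear M -> g}) : Prop :=
  forall m n, br (T m) (T n) = T (brT T m n).

Definition act_bar (T : M -> g) (m : M) (x : g) : g :=
  br (T m) x + T (act x m).

Definition twilled_br (T : M -> g) (p q : g * M) : g * M :=
  (br p.1 q.1 + act_bar T p.2 q.1 - act_bar T q.2 p.1,
   act p.1 q.2 - act q.1 p.2 + brT T p.2 q.2).

Definition Nijenhuis_operator (N : {linear g -> g}) : Prop :=
  forall x y, br (N x) (N y) = N (br (N x) y + br x (N y) - N (br x y)).

Definition Nijenhuis_structure (N : {linear g -> g}) (S : {linear M -> M}) : Prop :=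
  Nijenhuis_operator N
  /\ forall x m,
       act (N x) (S m) = S (act (N x) m) + act x (S (S m)) - S (act x (S m)).

Definition brTS (T : M -> g) (S : M -> M) (m n : M) : M :=
  brT T (S m) n + brT T m (S n) - S (brT T m n).

Definition ON_structure (T : {linear M -> g}) (N : {linear g -> g})
    (S : {linear M -> M}) : Prop :=
  [/\ O_operator T,
      Nijenhuis_structure N S,
      forall m, N (T m) = T (S m)
    & forall m n, brT (N \o T) m n = brTS T S m n].

End Operators.

End LieAlgebras.

Lemma zabel_start (V : zmodType) (x y : V) : 0 + x - y = 0 -> x = y.
Proof. by rewrite add0r => /eqP; rewrite subr_eq0 => /eqP. Qed.
Local Ltac zstep :=
  match goal with
  | |- context [- ?a] => do 14? rewrite (addrAC _ (- a)); do 14? rewrite (addrAC _ a); rewrite subrK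
  end.
Local Ltac zabel :=
  apply: zabel_start; rewrite ?(opprD, opprK, addrA, oppr0, addr0);
  repeat zstep; try reflexivity.


Section TwilledO.
Variable K : fieldType.

Lemma bilinear_zmod (U V W : lmodType K) (f : U -> V -> W) :
  is_bilinear f ->
  [/\ forall x y v, f (x + y) v = f x v + f y v,
      forall x v, f (- x) v = - f x v,
      forall u v w, f u (v + w) = f u v + f u w,
      forall u v, f u (- v) = - f u v & (forall u, f u 0 = 0) /\ (forall v, f 0 v = 0)].
Proof.
case=> fl fr.
have Dl x y v : f (x + y) v = f x v + f y v by have := fl v 1 x y; rewrite !scale1r.
have Dr u x y : f u (x + y) = f u x + f u y by have := fr u 1 x y; rewrite !scale1r.
have l0 v : f 0 v = 0 by apply: (@addrI _ (f 0 v)); rewrite -Dl !addr0.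
have r0 u : f u 0 = 0 by apply: (@addrI _ (f u 0)); rewrite -Dr !addr0.
split=> // [x v|u v].
- by apply/eqP; rewrite -addr_eq0 -Dl addNr l0.
- by apply/eqP; rewrite -addr_eq0 -Dr addNr r0.
Qed.

Lemma twilled_brP (g M : lmodType K) (br : g -> g -> g) (act : g -> M -> M)
    (T : {linear M -> g}) :
  is_lie br -> is_lie_module br act -> O_operator br act T ->
  is_twilled (twilled_br br act T).
Proof.
move=> [bb b0 J] [ba aM] TO.
have [bDl bNl bDr bNr [br0 b0r]] := bilinear_zmod bb.
have [aDl aNl aDr aNr [ar0 a0r]] := bilinear_zmod ba.
have bC u v : br u v = - br v u.
  by apply/eqP; rewrite -addr_eq0; have := b0 (u + v); rewrite bDl !bDr !b0 add0r addr0 => ->.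
(* conjugate of the semidirect product bracket by (x, m) |-> (x + T m, m) *)
pose w (p q : g * M) := act (p.1 + T p.2) q.2 - act (q.1 + T q.2) p.2.
have E p q : twilled_br br act T p q = (br (p.1 + T p.2) (q.1 + T q.2) - T (w p q), w p q).
  case: p q => [x m] [y n]; rewrite /w /=.
  have wE : act (x + T m) n - act (y + T n) m = act x n - act y m + brT act T m n.
    rewrite /brT !aDl; zabel.
  rewrite /twilled_br /= wE; congr (_, _).
  rewrite (linearD T (act x n - act y m)) (linearB T (act x n)) -TO /act_bar !bDl !bDr (bC (T n) x); zabel.
have A p q : (twilled_br br act T p q).1 + T (twilled_br br act T p q).2
     = br (p.1 + T p.2) (q.1 + T q.2) by rewrite E /= subrK.
have bZl c x y : br (c *: x) y = c *: br x y by have := bb.1 y c x 0; rewrite /= !addr0 b0r addr0.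
have bZr c x y : br x (c *: y) = c *: br x y by have := bb.2 x c y 0; rewrite !addr0 br0 addr0.
have aZl c x y : act (c *: x) y = c *: act x y by have := ba.1 y c x 0; rewrite !addr0 a0r addr0.
have aZr c x y : act x (c *: y) = c *: act x y by have := ba.2 x c y 0; rewrite !addr0 ar0 addr0.
have lin := (bDl, bDr, bNl, bNr, aDl, aDr, aNl, aNr, bZl, bZr, aZl, aZr, linearD T, linearN T, linearZ_LR T, @scalerDr, @scalerN).
have Tinj (p q : g * M) : p.1 + T p.2 = q.1 + T q.2 -> p.2 = q.2 -> p = q.
  by case: p q => [x m] [y n] /= h e; move: h; rewrite e => /addIr ->.
split; first split.
- split=> [q c p1 p2|p c q1 q2]; rewrite /twilled_br /act_bar /brT;
    (apply: Tinj; [rewrite /= !lin; zabel | rewrite /= !lin; zabel]).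
- by move=> p; rewrite E b0 /w subrr linear0 subrr.
- pose f (p : g * M) := p.1 + T p.2.
  have fD p q : f (p + q) = f p + f q by rewrite /f /= (linearD T) addrACA.
  have fE p q : f (twilled_br br act T p q) = br (f p) (f q) by exact: A.
  have sE p q : (twilled_br br act T p q).2 = act (f p) q.2 - act (f q) p.2 by rewrite E.
  have sD (p q : g * M) : (p + q).2 = p.2 + q.2 by [].
  move=> p q r; apply: Tinj; rewrite -/(f _).
  + by rewrite !fD !fE J /= linear0 addr0.
  + by rewrite !sD !sE !fE !aM !aDr !aNr -[RHS]/(0 : M); zabel.
- by move=> x y; rewrite /twilled_br /= /brT !linear0 !(ar0, a0r) !subr0 addr0.
- by move=> u v; rewrite /twilled_br /= /act_bar !(br0, b0r, ar0, a0r, linear0) !addr0 subr0.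
Qed.

End TwilledO.

(* Main.v *)
(** With [N = T \o Omega] and [S = Omega \o T], the closedness of [Omega] reads
    [x . Omega y - y . Omega x = Omega [x, y]]; it turns the quadratic part of
    the Maurer-Cartan equation into
    [[Omega x, Omega y]^T = Omega ([N x, y] + [x, N y] - N [x, y])].
    Applying [T] gives the Nijenhuis identity for [N]. The compatibility of
    [(N, S)] at [(x, m)] comes from both equations at [y = T m] and from
    closedness at [(x, N (T m))]. The last ON condition is closedness at
    [(T m, T n)]. *)
Require Import Defs.
From mathcomp Require Import all_boot all_algebra.
Import GRing.Theory.
Local Open Scope ring_scope.

Lemma tw_componentsE (K : fieldType) (g M : lmodType K) (br : g -> g -> g)
    (act : g -> M -> M) (T : {linear M -> g}) :
  is_bilinear br -> is_bilinear act ->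
  let tw := twilled_br br act T in
  [/\ forall x y, tw_brL tw x y = br x y,
      forall u v, tw_brR tw u v = brT act T u v,
      forall x u, tw_act1 tw x u = act x u
    & forall u x, tw_act2 tw u x = act_bar br act T u x].
Proof.
move=> bb ba tw.
have [_ _ _ _ [br0 b0r]] := bilinear_zmod bb.
have [_ _ _ _ [ar0 a0r]] := bilinear_zmod ba.
split=> [x y|u v|x u|u x];
  rewrite /tw_brL /tw_brR /tw_act1 /tw_act2 /tw /twilled_br /act_bar /brT /=.
all: by rewrite !(linear0, br0, b0r, ar0, a0r, subr0, addr0, add0r, opprK).
Qed.

Lemma strong_MC_twilled_br (K : fieldType) (g M : lmodType K)
    (br : g -> g -> g) (act : g -> M -> M)
    (T : {linear M -> g}) (Omega : {linear g -> M}) :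
  is_lie br -> is_bilinear act ->
  strong_MC (twilled_br br act T) Omega ->
  (forall x y, act x (Omega y) - act y (Omega x) = Omega (br x y)) /\
  (forall x y, brT act T (Omega x) (Omega y) =
     Omega (br (T (Omega x)) y + br x (T (Omega y)) - T (Omega (br x y)))).
Proof.
move=> [bb b0 _] ba [d0 h0].
have [bDl _ bDr _ _] := bilinear_zmod bb.
have [EL ER E1 E2] := tw_componentsE _ _ _ _ _ T bb ba.
have bC u v : br u v = - br v u.
  by apply/eqP; rewrite -addr_eq0; have := b0 (u + v);
     rewrite bDl !bDr !b0 add0r addr0 => ->.
have closed x y : act x (Omega y) - act y (Omega x) = Omega (br x y).
  by apply/subr0_eq; have := d0 x y; rewrite /d_CE !E1 EL.
split=> // x y.
have := h0 x y; rewrite /half_mu2 ER !E2 -addrA => /eqP.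
rewrite addr_eq0 opprD opprK => /eqP ->.
(* The two [T (act _ _)] terms of [act_bar] combine into [T (Omega (br x y))] by closedness. *)
rewrite -closed -linearB; congr (Omega _).
by rewrite /act_bar linearB !opprB (bC _ x) opprD opprK addrACA.
Qed.

Theorem theorem6p6 (K : fieldType) (charK0 : [pchar K] =i pred0)
  (g M : lmodType K) (br : g -> g -> g) (act : g -> M -> M)
  (T : {linear M -> g}) (Omega : {linear g -> M}) :
  is_lie br ->
  is_lie_module br act ->
  O_operator br act T ->
  strong_MC (twilled_br br act T) Omega ->
  ON_structure br act T (T \o Omega) (Omega \o T).
Proof.
move=> lie_br [ba _] TO MC.
have [closed mu2] := strong_MC_twilled_br _ _ _ _ _ _ _ lie_br ba MC.
split=> //; first split=> [x y|x m] /=.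
- by rewrite TO mu2.
- have -> : act (T (Omega x)) (Omega (T m)) =
      brT act T (Omega x) (Omega (T m)) + act (T (Omega (T m))) (Omega x).
    by rewrite /brT subrK.
  have -> : act (T (Omega (T m))) (Omega x) =
      act x (Omega (T (Omega (T m)))) - Omega (br x (T (Omega (T m)))).
    by rewrite -closed opprB addrC subrK.
  (* [TO] and closedness at [(x, T m)] yield opposite copies of [Omega (T (act (T m) (Omega x)))];
     the two [Omega (br x _)] terms cancel too. *)
  rewrite mu2 TO -(closed x (T m)) /brT !(linearB, linearD) /=.
  rewrite [X in X + _]addrAC [X in _ + X = _]addrC addrA addrK.
  by rewrite opprK [- _ + _]addrC subrKA addrAC.
(* [TO] makes the last term of [brTS] into [Omega (br (T m) (T n))], which cancels the actions on
   [Omega (T m)] and [Omega (T n)]. *)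
- by move=> m n; rewrite /brTS /= -TO -closed /brT /= opprB addrAC !subrKA.
Qed.
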